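(* There is no real number $c$ such that $Z(L(G))\leq c\,b(G)$ for all finite simple graphs $G$.
   Context: For a finite simple graph $H$: colour each vertex black or white. A black vertex $v$ may force a white neighbour $w$ to become black if $w$ is the only white neighbour of $v$. A set $S\subseteq V(H)$ is a zero-forcing set if, colouring exactly the vertices of $S$ black and repeatedly applying this rule, all vertices eventually become black. The zero-forcing number $Z(H)$ is the minimum size of a zero-forcing set. Brushing: initially every vertex and every edge of $G$ is dirty. An initial configuration places a nonnegative integer number of brushes at each vertex. At each step a single remaining vertex $v$ fires; $v$ may fire only if the number of brushes currently at $v$ is at least the number of dirty edges currently incident with $v$. When $v$ fires, $v$ becomes clean, and along each dirty edge incident with $v$ exactly one brush is moved to the other endpoint, cleaning that edge; the remaining brushes stay at $v$ and play no further role; $v$ and its incident edges are then removed. The process ends when no vertex can fire. A configuration cleans $G$ if some such process cleans all vertices and edges. $b(G)$ is the minimum total number of brushes in a configuration that cleans $G$. $L(G)$ denotes the line graph of $G$: its vertices are the edges of $G$, two being adjacent iff they share an endpoint in $G$. *)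

(* Defs.v *)
From HB Require Import structures.
From mathcomp Require Import all_boot all_order all_algebra.
From mathcomp Require Import boolp reals.

Set Implicit Arguments.
Unset Strict Implicit.
Unset Printing Implicit Defensive.

Record sgraph := SGraph {
  vertex :> finType;
  adj : rel vertex;
  adj_sym : symmetric adj;
  adj_irrefl : irreflexive adj }.

Definition edges (G : sgraph) : {set {set G}} :=
  [set [set p.1; p.2] | p : G * G & adj p.1 p.2].

Section LineGraph.
Variable G : sgraph.

Definition edge_type := {e : {set G} | e \in edges G}.

Definition line_adj : rel edge_type :=
  fun e f => (e != f) && (val e :&: val f != set0).

Lemma line_adj_sym : symmetric line_adj.
Proof. by move=> e f; rewrite /line_adj eq_sym setIC. Qed.

Lemma line_adj_irrefl : irreflexive line_adj.
Proof. by move=> e; rewrite /line_adj eqxx. Qed.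

Definition line_graph : sgraph := SGraph line_adj_sym line_adj_irrefl.

End LineGraph.

Section ZeroForcing.
Variable H : sgraph.
Implicit Types B S : {set H}.

(* B is the set of black vertices. *)
Definition forces B (v w : H) : bool :=
  (v \in B) && ([set u | adj v u & u \notin B] == [set w]).

Definition force_step : rel {set H} :=
  fun B B' => [exists v, exists w, forces B v w && (B' == w |: B)].

Definition zero_forcing_set S : bool := connect force_step S [set: H].

(* The whole vertex set is zero-forcing, so the minimum is genuine. *)
Lemma zero_forcing_setT : zero_forcing_set [set: H].
Proof. exact: connect0. Qed.

Definition zero_forcing_number : nat :=
  #|[arg min_(S < [set: H] | zero_forcing_set S) #|S| ]|.

End ZeroForcing.

Section Brushing.
Variable G : sgraph.

Record brush_state := BrushState {
  remaining : {set G};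
  dirty : {set {set G}};
  brushes : {ffun G -> nat} }.

Implicit Types (s : brush_state) (v : G) (w : {ffun G -> nat}).

Definition brush_init w : brush_state := BrushState [set: G] (edges G) w.

Definition dirty_at s v : {set {set G}} := [set e in dirty s | v \in e].

Definition can_fire s v : bool :=
  (v \in remaining s) && (#|dirty_at s v| <= brushes s v).

Definition fire s v : brush_state :=
  BrushState (remaining s :\ v) (dirty s :\: dirty_at s v)
    [ffun u => if u == v then brushes s v - #|dirty_at s v|
               else brushes s u + ([set v; u] \in dirty s)].

(* Firing the vertices of vs in order is legal and leaves everything clean. *)
Fixpoint cleaning_run s (vs : seq G) : bool :=
  if vs is v :: vs' then can_fire s v && cleaning_run (fire s v) vs'
  else (remaining s == set0) && (dirty s == set0).

Definition cleans w : Prop := exists vs, cleaning_run (brush_init w) vs.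

Definition cleanable_with (n : nat) : Prop :=
  exists w, cleans w /\ \sum_v w v = n.

Lemma cleaning_run_ample s (vs : seq G) :
  remaining s =i vs -> uniq vs ->
  (forall e, e \in dirty s -> (e != set0) && (e \subset remaining s)) ->
  (forall v, v \in vs -> #|dirty_at s v| <= brushes s v) ->
  cleaning_run s vs.
Proof.
elim: vs s => [|v vs IH] s Rs /=.
  move=> _ De _; have R0 : remaining s = set0.
    by apply/setP=> x; rewrite Rs !inE.
  rewrite R0 eqxx /=; apply/eqP/setP=> e; rewrite inE; apply/negP=> /De.
  by rewrite R0 subset0 => /andP[/negP].
case/andP=> vNvs uvs De Bs; rewrite /can_fire Rs mem_head Bs ?mem_head //=.
apply: IH => //=.
- move=> x; rewrite !inE Rs inE; case: eqVneq => //= ->.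
  by rewrite (negPf vNvs).
- move=> e; rewrite !inE negb_and => /andP[ve eD]; case/andP: (De e eD) => -> eR.
  by rewrite eD /= in ve; rewrite subsetD1 eR ve.
move=> u uvs'; rewrite ffunE.
have -> : (u == v) = false by apply: contraNF vNvs => /eqP <-.
apply: leq_trans (leq_addr _ _); apply: leq_trans (Bs u _); last first.
  by rewrite inE uvs' orbT.
by apply/subset_leq_card/subsetP=> e; rewrite !inE => /andP[/andP[_ ->] ->].
Qed.

Lemma cleanable_with_some : exists n, `[< cleanable_with n >].
Proof.
pose w : {ffun G -> nat} := [ffun v => #|dirty_at (brush_init [ffun=> 0]) v|].
exists (\sum_v w v); apply/asboolP; exists w; split=> //; exists (enum G).
apply: cleaning_run_ample => /=.
- by move=> x; rewrite mem_enum !inE.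
- exact: enum_uniq.
- move=> e /imsetP[p _ ->]; rewrite subsetT andbT.
  by apply/set0Pn; exists p.1; rewrite !inE eqxx.
- by move=> v _; rewrite ffunE.
Qed.

Definition brush_number : nat := ex_minn cleanable_with_some.

End Brushing.

(* Main.v *)
Require Import Defs.
From mathcomp Require Import all_boot all_order all_algebra reals.
From mathcomp Require Import boolp zify.
Import Order.TTheory GRing.Theory Num.Theory.
Local Open Scope ring_scope.

(** If an edge [e] forces an edge [f] in the line graph and [x] is a common
    endpoint, then [f] is the last white edge at [x]: every force saturates a new
    vertex of [G], so [Z(L(G)) >= |E(G)| - |V(G)|].  The square of a path has
    about twice as many edges as vertices, but three brushes sweep it from one
    end to the other because every inner vertex passes on exactly as many brushes
    as it receives. *)

Section LineGraphForcing.
Local Open Scope nat_scope.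
Variable G : sgraph.
Implicit Types B : {set line_graph G}.

Definition saturated B : {set G} :=
  [set x | [forall e : line_graph G, (x \in val e) ==> (e \in B)]].

Lemma card_line_graph : #|line_graph G| = #|edges G|.
Proof. exact: card_sig. Qed.

(** One edge [f] turns black, and a common endpoint [x] of [f] and its forcer becomes saturated, so
    [#|B| - #|saturated B|] never grows along a step; the sums avoid truncated subtraction. *)
Lemma force_step_saturated {B B'} : force_step B B' ->
  #|B'| + #|saturated B| <= #|B| + #|saturated B'|.
Proof.
case/existsP=> e /existsP[f /andP[/andP[eB /eqP whiteN] /eqP ->]].
have : f \in [set u | adj e u & u \notin B] by rewrite whiteN set11.
rewrite inE => /andP[/andP[_ /set0Pn[x /setIP[xe xf]]] fB].
rewrite cardsU1 fB addnAC [X in X <= _]addnC leq_add2l add1n.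
apply: proper_card; apply/properP; split.
  apply/subsetP=> y; rewrite !inE => /forallP sat_y; apply/forallP=> g.
  by apply/implyP=> /(implyP (sat_y g)) gB; rewrite !inE gB orbT.
exists x; rewrite !inE; last first.
  by apply/negP=> /forallP/(_ f); rewrite xf (negPf fB).
apply/forallP=> g; apply/implyP=> xg; rewrite !inE -implyNb.
(* A white edge [g] at [x] differs from the black [e] and meets it in [x]; it is a white neighbour
   of [e], hence [f]. *)
apply/implyP=> gNf; apply: contraR gNf => gB.
have : g \in [set u | adj e u & u \notin B].
  rewrite inE gB andbT; apply/andP; split; first by apply: contraNneq gB => <-.
  by apply/set0Pn; exists x; rewrite inE xe.
by rewrite whiteN inE.
Qed.

Lemma connect_force_saturated {B B'} : connect (@force_step _) B B' ->
  #|B'| + #|saturated B| <= #|B| + #|saturated B'|.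
Proof.
case/connectP=> p + ->; elim: p B => [//|C p IH] B.
rewrite last_cons => /andP[/force_step_saturated BC /IH Cp].
lia.
Qed.

(** Compare a minimum zero-forcing set with the all-black set, in which at most [#|G|] vertices are
    saturated. *)
Lemma zero_forcing_line_graph :
  #|edges G| <= zero_forcing_number (line_graph G) + #|G|.
Proof.
rewrite /zero_forcing_number; case: arg_minnP => [|S zfS _].
  exact: zero_forcing_setT.
have := connect_force_saturated zfS; rewrite cardsT card_line_graph => le_E.
apply: leq_trans (leq_addr _ _) (leq_trans le_E _).
by rewrite leq_add2l max_card.
Qed.

End LineGraphForcing.

Section PathSquare.
Local Open Scope nat_scope.
Variable k : nat.

Definition path_square_adj : rel 'I_k.+2 :=
  fun i j => [&& i != j, i <= j.+2 & j <= i.+2].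

Lemma path_square_adj_sym : symmetric path_square_adj.
Proof. by move=> i j; rewrite /path_square_adj eq_sym; congr (_ && _); rewrite andbC. Qed.

Lemma path_square_adj_irrefl : irreflexive path_square_adj.
Proof. by move=> i; rewrite /path_square_adj eqxx. Qed.

Definition path_square : sgraph :=
  SGraph path_square_adj_sym path_square_adj_irrefl.

Lemma mem_edges_path_square (i j : path_square) :
  path_square_adj i j -> [set i; j] \in edges path_square.
Proof. by move=> ij; apply/imsetP; exists (i, j); rewrite ?inE. Qed.

(** Each of the first [k] vertices has two forward edges, to [i + 1] and [i + 2]; the boolean in [f]
    selects one. The edge between the last two vertices is left out. *)
Lemma card_edges_path_square : k.*2 <= #|edges path_square|.
Proof.
pose f (p : bool * 'I_k) : {set path_square} :=
  [set inord p.2; inord (p.2 + p.1).+1].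
have f_inj : injective f.
  move=> [a i] [b j] eq_f.
  have [ik jk] := (ltn_ord i, ltn_ord j).
  have [a1 b1] := (leq_b1 a, leq_b1 b).
  have : inord i \in f (b, j) by rewrite -eq_f !inE eqxx.
  have : inord (i + a).+1 \in f (b, j) by rewrite -eq_f !inE eqxx orbT.
  have : inord j \in f (a, i) by rewrite eq_f !inE eqxx.
  have : inord (j + b).+1 \in f (a, i) by rewrite eq_f !inE eqxx orbT.
  rewrite !inE -!val_eqE /= !inordK; try lia.
  move=> bj' j' ai' i'; have ij : i = j by apply: val_inj => /=; lia.
  by rewrite ij; congr pair; lia.
rewrite -mul2n -card_bool -[k in _ * k]card_ord -card_prod -(card_imset _ f_inj).
apply/subset_leq_card/subsetP=> _ /imsetP[[a i] _ ->].
apply: mem_edges_path_square; have ik := ltn_ord i.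
by rewrite /path_square_adj -!val_eqE /= !inordK; case: a; lia.
Qed.

(* [i.+2 - j] truncates: it asks for two brushes at [i], one at [i + 1] and none
   beyond. *)
Lemma cleaning_run_path_square (i : nat) (s : brush_state path_square) :
  i <= k.+2 ->
  remaining s = [set j : 'I_k.+2 | i <= j] ->
  dirty s = [set e in edges path_square | e \subset remaining s] ->
  (forall j : 'I_k.+2, i <= j -> i.+2 - j <= brushes s j) ->
  cleaning_run s (drop i (enum 'I_k.+2)).
Proof.
move En: (k.+2 - i) => n; elim: n i s En => [|n IH] i s En ik Rs Ds Bs.
  have -> : i = k.+2 by lia.
  rewrite drop_oversize ?size_enum_ord //=.
  have R0 : remaining s = set0.
    by rewrite Rs; apply/setP=> j; rewrite !inE; have := ltn_ord j; lia.
  rewrite R0 eqxx Ds; apply/eqP/setP=> e; rewrite !inE R0 subset0.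
  by apply/negP=> /andP[/imsetP[p _ ->] /eqP/setP/(_ p.1)]; rewrite !inE eqxx.
have lt_ik : i < k.+2 by lia.
rewrite (drop_nth ord0) ?size_enum_ord //=.
set v : 'I_k.+2 := nth _ _ _; have vE : v = i :> nat by rewrite /v nth_enum_ord.
(* Only forward edges of [v] are still dirty, since all earlier vertices have fired. *)
have dirtyE (e : {set path_square}) : e \in dirty s -> v \in e ->
    exists2 u : 'I_k.+2, e = [set v; u] & i < u <= i.+2.
  rewrite Ds !inE => /andP[/imsetP[[a b] ab ->] /=].
  rewrite Rs subUset !sub1set !inE => /andP[ia ib].
  move: ab; rewrite inE /= /path_square_adj -val_eqE /= => /and3P[ab ba' ab'].
  case/orP=> /eqP va; have /= := congr1 val va; rewrite vE => va'.
    by exists b; rewrite ?va //; lia.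
  by exists a; rewrite ?va 1?setUC //; lia.
have deg : #|dirty_at s v| <= 2.
  (* Past the end of the path [inord] defaults to vertex 0; this is harmless, as the pair only has
     to cover the dirty edges. *)
  apply: (@leq_trans #|[set [set v; inord i.+1]; [set v; inord i.+2]] : {set {set path_square}}|);
    last by rewrite cards2; case: eqP.
  apply/subset_leq_card/subsetP=> e; rewrite inE => /andP[/dirtyE De /De[u -> ui]].
  have /orP[/eqP ->|/eqP ->] : (i.+1 == u) || (i.+2 == u) by lia.
    by rewrite inord_val !inE eqxx.
  by rewrite inord_val !inE eqxx orbT.
have := Bs v; rewrite /can_fire Rs inE vE leqnn => /(_ isT) Bv /=.
apply/andP; split; first by apply: leq_trans deg (leq_trans _ Bv); lia.
have R' : remaining (fire s v) = [set j : 'I_k.+2 | i < j].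
  by rewrite /= Rs; apply/setP=> j; rewrite !inE -val_eqE /= vE; lia.
apply: IH; rewrite ?R' //=; first by lia.
- apply/setP=> e; rewrite !inE.
  have <- : remaining s :\ v = [set j : 'I_k.+2 | i < j] by [].
  by rewrite subsetD1 Ds !inE; case: (_ \in edges _); case: (_ \subset _); case: (v \in e).
(* Moving from [i] to [i + 1] raises the demand at [j] by one exactly when [j <= i + 2], and these
   [j] are the vertices to which [v] sends a brush. *)
- move=> j ij; rewrite ffunE -val_eqE /= vE ifN; last by lia.
  have Bj := Bs j (ltnW ij); have [jle|] := leqP j i.+2; last by lia.
  suff -> : [set v; j] \in dirty s by rewrite addn1 subSn.
  rewrite Ds inE mem_edges_path_square /=; last first.
    by rewrite /path_square_adj -val_eqE /= vE; lia.
  by rewrite Rs subUset !sub1set !inE vE leqnn ltnW.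
Qed.

Lemma brush_number_path_square : brush_number path_square <= 3.
Proof.
rewrite /brush_number; case: ex_minnP => m _; apply; apply/asboolP.
(* The demand of the sweep at [i = 0]: two brushes at vertex 0 and one at vertex 1. *)
exists [ffun j : 'I_k.+2 => 2 - j]; split; last first.
  under eq_bigr do rewrite ffunE.
  by rewrite /= !big_ord_recl big1.
exists (enum 'I_k.+2); rewrite -[enum _]drop0; apply: cleaning_run_path_square => //=.
- by apply/setP=> e; rewrite inE subsetT andbT.
- by move=> j _; rewrite ffunE.
Qed.

End PathSquare.

Theorem theorem3 (R : realType) :
  ~ exists c : R, forall G : sgraph,
      (zero_forcing_number (line_graph G))%:R <= c * (brush_number G)%:R.
Proof.
(* This gives [m > 3|c|]; the absolute value covers negative [c]. *)
case=> c le_c; pose m := Num.bound (`|c| * 3).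
have := le_c (path_square m.+2); apply/negP; rewrite -ltNge.
(* There are [m + 4] vertices and at least [2(m + 2)] edges, a difference of at least [m]. *)
have Zm : (m <= zero_forcing_number (line_graph (path_square m.+2)))%N.
  have := zero_forcing_line_graph (path_square m.+2).
  have := card_edges_path_square m.+2; rewrite /= card_ord; lia.
apply: (@lt_le_trans _ _ m%:R); last by rewrite ler_nat.
apply: le_lt_trans (archi_boundP _); last by rewrite mulr_ge0.
apply: (@le_trans _ _ (`|c| * (brush_number (path_square m.+2))%:R)).
  by rewrite ler_wpM2r ?ler_norm.
by rewrite ler_wpM2l // (ler_nat _ _ 3) brush_number_path_square.
Qed.
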